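(* Let $\alpha\in\mathbb R$ with $\alpha\neq 1$, let $R_0>0$, and let $P>0$ be arbitrary. Then for the Gaussian primitive relay channel with perfectly correlated noises, with relay gain $\alpha$, relay-link capacity $R_0$ and power constraint $P$, the rate $R_0$ is achievable by modulo quantization (MQ) coding: for every $\epsilon>0$ there is $n_0$ such that for every $n\ge n_0$ there exists an MQ code of blocklength $n$ (as defined in the context, respecting the power constraint $P$ and the relay-link capacity $R_0$) with at least $\lfloor 2^{nR_0}\rfloor$ messages and with error probability $P_e^{(n)}\le\epsilon$.
   Context: All logarithms are base 2. For a positive integer $k$, $[k]=\{0,1,\dots,k-1\}$, and for $a\in\mathbb Z$, $a \bmod k\in[k]$ denotes the remainder of $a$ divided by $k$. For $\Delta>0$ and $k\in\mathbb Z_{>0}$, the $(\Delta,k)$-modulo quantization is the map $q_{\Delta,k}:\mathbb R\to[k]$, $q_{\Delta,k}(x)=\lfloor x/\Delta\rfloor \bmod k$. Gaussian primitive relay channel with perfectly correlated noises: in each channel use, given the input $X\in\mathbb R$, the receiver observes $Y=X+Z$ and the relay observes $Y_0=\alpha X+Z$, with the same noise $Z\sim\mathcal N(0,1)$; noises are i.i.d. across channel uses and independent of the message. The relay has a noiseless link of capacity $R_0$ bits per channel use to the receiver. A code of blocklength $n$ consists of an encoder $m\mapsto x^n(m)\in\mathbb R^n$ from a finite message set, with $\frac1n\|x^n(m)\|^2\le P$ for every message $m$; a relay function mapping $Y_0^n$ to a message $V$ in a set of size at most $2^{nR_0}$; and a decoder mapping $(Y^n,V)$ to an estimate $\hat M$.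 The error probability is $P_e^{(n)}=\Pr\{\hat M\ne M\}$, with $M$ uniform on the message set. MQ code of blocklength $n$: choose positive integers $K_1,\dots,K_n$ with $\prod_{i=1}^n K_i\le 2^{nR_0}$ and step sizes $\Delta_1,\dots,\Delta_n>0$. The message set is $[K_1]\times\cdots\times[K_n]$; message $(m_1,\dots,m_n)$ is encoded as $x_i=m_i\Delta_i/(\alpha-1)$, $1\le i\le n$ (the step sizes being such that the power constraint holds); the relay forwards $V_i=q_{\Delta_i,K_i}(Y_{0,i})$ for $1\le i\le n$; and the receiver outputs $\hat M_i=(V_i-q_{\Delta_i,K_i}(Y_i))\bmod K_i$ for $1\le i\le n$. (This is the scalar MQ scheme used in every channel use, with time-sharing between scalar MQ schemes of different moduli.) *)

(* Defs.v *)
From HB Require Import structures.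
From mathcomp Require Import all_boot all_order all_algebra.
From mathcomp Require Import all_classical all_reals all_analysis.
Set Implicit Arguments.
Unset Strict Implicit.
Unset Printing Implicit Defensive.
Import Order.TTheory GRing.Theory Num.Theory.
Local Open Scope classical_set_scope.
Local Open Scope ring_scope.

Lemma absz_mod_lt (k : nat) (a : int) :
  (0 < k)%N -> (absz (a %% k%:Z)%Z < k)%N.
Proof.
move=> k0; have k0' : k%:Z != 0 by rewrite eqz_nat -lt0n.
by rewrite -ltz_nat gez0_abs ?modz_ge0// ltz_pmod.
Qed.

(* As (a %% k)%Z is the least nonnegative remainder, absz loses nothing. *)
Definition residue (k : nat) (k0 : (0 < k)%N) (a : int) : 'I_k :=
  Ordinal (absz_mod_lt a k0).

Definition mod_quant (R : realType) (D : R) (k : nat) (k0 : (0 < k)%N)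
  (x : R) : 'I_k := residue k0 (Num.floor (x / D)).

Lemma measurable_mod_quant (R : realType) (D : R) (k : nat) (k0 : (0 < k)%N)
  (v : 'I_k) : measurable [set x : R | mod_quant D k0 x = v].
Proof.
pose F (j : int) : set R :=
  if residue k0 j == v then `[j%:~R, (j + 1)%:~R[%classic else set0.
have mF : measurable (\bigcup_j F j).
  apply: countable_bigcupT_measurable => [|j]; first exact: countableP.
  by rewrite /F; case: ifP => _ //; exact: measurable_itv.
have -> : [set x : R | mod_quant D k0 x = v] =
    (fun x => x * D^-1) @^-1` (\bigcup_j F j).
  apply/seteqP; split => x /=.
    rewrite /mod_quant => xv; exists (Num.floor (x / D)) => //=.
    rewrite /F xv eqxx /= in_itv /=.
    by rewrite floor_le floorD1_gt.
  move=> [j _]; rewrite /F; case: ifP => [/eqP jv|//].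
  by rewrite /= in_itv /= => /floor_def jE; rewrite /mod_quant jE.
rewrite -[X in measurable X]setTI.
have mD : measurable_fun [set: R] (fun x => x * D^-1).
  exact: measurable_realfun.mulrr_measurable.
exact: mD.
Qed.

(* Measurability of the relay map and of the decoder, tacit in the informal
   definition of a code, makes decoding errors measurable events. *)
Record relay_code (R : realType) (n : nat) := RelayCode {
  message : finType;
  link : finType;
  encode : message -> n.-tuple R;
  relay : n.-tuple R -> link;
  decode : n.-tuple R -> link -> message;
  measurable_relay : forall v, measurable [set y0 | relay y0 = v];
  measurable_decode : forall v m, measurable [set y | decode y v = m] }.

Arguments encode {R n} _ _.
Arguments relay {R n} _ _.
Arguments decode {R n} _ _ _.

Definition power_constraint (R : realType) (n : nat) (P : R)
    (c : relay_code R n) : Prop :=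
  forall m : message c, n%:R^-1 * \sum_(i < n) tnth (encode c m) i ^+ 2 <= P.

Definition link_constraint (R : realType) (n : nat) (R0 : R)
    (c : relay_code R n) : Prop :=
  #|link c|%:R <= 2 `^ (n%:R * R0).

Section channel.
Context d (Omega : measurableType d) (R : realType) (Pr : probability Omega R).
Variables (n : nat) (alpha : R) (c : relay_code R n).
Variables (M : Omega -> message c) (Z : 'I_n -> {RV Pr >-> R}).

(* M is uniform, the Z i are N(0, 1), and M, Z 0, Z 1, ... are mutually
   independent: the product rule for subfamilies follows by taking
   A i := setT and by summing over m. *)
Definition channel_law : Prop :=
  [/\ forall m, measurable (M @^-1` [set m]),
      forall m, Pr (M @^-1` [set m]) = (#|message c|%:R^-1)%:E,
      forall i (A : set R), measurable A ->
        distribution Pr (Z i) A = normal_prob 0 1 A &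
      forall m (A : 'I_n -> set R), (forall i, measurable (A i)) ->
        Pr (M @^-1` [set m] `&` \bigcap_(i in [set: 'I_n]) (Z i @^-1` A i)) =
        (Pr (M @^-1` [set m]) * \prod_(i < n) Pr (Z i @^-1` A i))%E].

Definition received (w : Omega) : n.-tuple R :=
  [tuple tnth (encode c (M w)) i + Z i w | i < n].

Definition relay_received (w : Omega) : n.-tuple R :=
  [tuple alpha * tnth (encode c (M w)) i + Z i w | i < n].

Definition estimate (w : Omega) : message c :=
  decode c (received w) (relay c (relay_received w)).

Definition error_probability : \bar R := Pr [set w | estimate w <> M w].

End channel.

Record mq_scheme (R : realType) (R0 : R) (n : nat) := MQScheme {
  modulus : 'I_n -> nat;
  step : 'I_n -> R;
  modulus_gt0 : forall i, (0 < modulus i)%N;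
  step_gt0 : forall i, 0 < step i;
  modulus_link : (\prod_(i < n) modulus i)%N%:R <= 2 `^ (n%:R * R0) }.

Section mq_code.
Variables (R : realType) (alpha R0 : R) (n : nat) (s : mq_scheme R0 n).

(* The product [K_1] x ... x [K_n]. *)
Definition mq_index : finType := {dffun forall i : 'I_n, 'I_(modulus s i)}.

Definition mq_quant (i : 'I_n) (x : R) : 'I_(modulus s i) :=
  mod_quant (step s i) (modulus_gt0 s i) x.

Definition mq_encode (m : mq_index) : n.-tuple R :=
  [tuple (m i)%:R * step s i / (alpha - 1) | i < n].

Definition mq_relay (y0 : n.-tuple R) : mq_index :=
  [ffun i => mq_quant i (tnth y0 i)].

Definition mq_decode (y : n.-tuple R) (v : mq_index) : mq_index :=
  [ffun i => residue (modulus_gt0 s i)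
               ((v i)%:Z - (mq_quant i (tnth y i))%:Z)].

Lemma measurable_mq_quant (i : 'I_n) (A : set 'I_(modulus s i)) :
  measurable [set y : n.-tuple R | A (mq_quant i (tnth y i))].
Proof.
have -> : [set y : n.-tuple R | A (mq_quant i (tnth y i))] =
    [set: n.-tuple R] `&` (@tnth n R)^~ i @^-1`
      (\bigcup_(u in A) [set x | mq_quant i x = u]).
  rewrite setTI; apply/seteqP; split => y /=; first by move=> Ay; exists (mq_quant i (tnth y i)).
  by move=> [u Au ->].
apply: measurable_tnth => //.
apply: fin_bigcup_measurable => [|u _]; first exact: finite_finset.
exact: measurable_mod_quant.
Qed.

Lemma measurable_mq_relay v : measurable [set y0 | mq_relay y0 = v].
Proof.
have -> : [set y0 | mq_relay y0 = v] = \bigcap_(i in [set: 'I_n])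
    [set y0 | [set v i] (mq_quant i (tnth y0 i))].
  apply/seteqP; split => y /=; first by move=> <- i _ /=; rewrite ffunE.
  by move=> yv; apply/ffunP => i; rewrite ffunE; exact: yv.
apply: fin_bigcap_measurable => [|i _]; first exact: finite_finset.
exact: measurable_mq_quant.
Qed.

Lemma measurable_mq_decode v m : measurable [set y | mq_decode y v = m].
Proof.
have -> : [set y | mq_decode y v = m] = \bigcap_(i in [set: 'I_n])
    [set y | [set u : 'I_(modulus s i) |
      residue (modulus_gt0 s i) ((v i)%:Z - u%:Z) = m i]
      (mq_quant i (tnth y i))].
  apply/seteqP; split => y /=; first by move=> <- i _ /=; rewrite ffunE.
  by move=> yv; apply/ffunP => i; rewrite ffunE; exact: yv.
apply: fin_bigcap_measurable => [|i _]; first exact: finite_finset.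
exact: measurable_mq_quant.
Qed.

Definition mq_code : relay_code R n :=
  RelayCode mq_encode measurable_mq_relay measurable_mq_decode.

End mq_code.

(* Main.v *)
Require Import Defs.
From mathcomp Require Import all_boot all_order all_algebra.
From mathcomp Require Import all_classical all_reals all_analysis.
Import Order.TTheory GRing.Theory Num.Theory.
Local Open Scope classical_set_scope.
Local Open Scope ring_scope.

(** The relay and the receiver see the same noise, so their observations differ
    by exactly [(alpha - 1) x_i = m_i Delta_i], and adding [m_i Delta_i] shifts
    [floor (_ / Delta_i)] by [m_i]: the decoder is never wrong, whatever the
    moduli and the steps.  The steps can thus be taken as small as the power
    constraint requires, and all the rate can be put on the first channel use:
    [K_1 = floor (2 `^ (n R0))] and all other moduli equal to 1. *)

Lemma residueE (k : nat) (k0 : (0 < k)%N) (a : int) :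
  (residue k0 a)%:Z = (a %% k%:Z)%Z.
Proof. by rewrite /= gez0_abs// modz_ge0// eqz_nat -lt0n. Qed.

(** The two floors differ by [m]. Reducing each modulo [k] is harmless, as the outer [residue] is
    taken modulo [k] too, and [m < k] is its own remainder. *)
Lemma residue_mod_quant_sub (R : realType) (D : R) (k : nat) (k0 : (0 < k)%N)
    (x : R) (m : 'I_k) : D != 0 ->
  residue k0 ((mod_quant D k0 (x + m%:R * D))%:Z - (mod_quant D k0 x)%:Z) = m.
Proof.
move=> D0; apply/val_inj/eqP; rewrite -eqz_nat; apply/eqP.
rewrite residueE /mod_quant !residueE mulrDl mulfK// floorDrz ?natr_int//.
rewrite pmulrn intrKfloor modzDml -modzDmr modzNm modzDmr.
by rewrite addrAC subrr add0r modz_small//= ltz_nat ltn_ord.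
Qed.

Lemma card_mq_index (R : realType) (R0 : R) (n : nat) (s : mq_scheme R0 n) :
  #|mq_index s| = (\prod_(i < n) modulus s i)%N.
Proof.
rewrite card_dep_ffun foldrE big_map big_enum.
by apply: eq_bigr => i _; rewrite card_ord.
Qed.

Lemma link_constraint_mq_code (R : realType) (alpha R0 : R) (n : nat)
  (s : mq_scheme R0 n) : link_constraint R0 (mq_code alpha s).
Proof. by rewrite /link_constraint/= card_mq_index modulus_link. Qed.

Lemma estimate_mq_code (d : measure_display) (Omega : measurableType d)
    (R : realType) (Pr : probability Omega R) (n : nat) (alpha R0 : R)
    (s : mq_scheme R0 n) (M : Omega -> message (mq_code alpha s))
    (Z : 'I_n -> {RV Pr >-> R}) (w : Omega) :
  alpha != 1 -> estimate alpha M Z w = M w.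
Proof.
move=> alpha1; have a0 : alpha - 1 != 0 by rewrite subr_eq0.
apply/ffunP => i; rewrite /estimate/= !ffunE !tnth_mktuple /mq_quant.
set x := (M w i)%:R * step s i / (alpha - 1).
(* The relay's observation is the receiver's plus [(alpha - 1) * x]; the common noise is carried
   along unchanged. *)
have -> : alpha * x + Z i w = x + Z i w + (M w i)%:R * step s i.
  rewrite -[(M w i)%:R * step s i](divfK a0) -/x mulrBr mulr1 (mulrC x).
  by rewrite [RHS]addrC addrA subrK.
by rewrite residue_mod_quant_sub// gt_eqF// step_gt0.
Qed.

(** Since [m i < modulus s i], every symbol has energy at most that of the fictitious symbol with
    [m i = modulus s i]; averaging keeps the bound [P]. *)
Lemma power_constraint_mq_code (R : realType) (alpha R0 P : R) (n : nat)
    (s : mq_scheme R0 n) : (0 < n)%N ->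
  (forall i, ((modulus s i)%:R * step s i / (alpha - 1)) ^+ 2 <= P) ->
  power_constraint P (mq_code alpha s).
Proof.
move=> n0 sP m; rewrite ler_pdivrMl ?ltr0n//.
have -> : n%:R * P = \sum_(i < n) P by rewrite sumr_const card_ord mulr_natl.
apply: ler_sum => i _; rewrite tnth_mktuple; apply: le_trans (sP i).
rewrite !exprMn !ler_wpM2r ?sqr_ge0//.
by rewrite ler_sqr ?nnegrE ?ler0n// ler_nat ltnW.
Qed.

Theorem proposition1 (R : realType) (alpha R0 P : R)
    (halpha : alpha != 1) (hR0 : 0 < R0) (hP : 0 < P) (eps : R)
    (heps : 0 < eps) :
  exists n0 : nat, forall n : nat, (n0 <= n)%N ->
    exists s : mq_scheme R0 n,
      let c := mq_code alpha s in
      [/\ power_constraint P c,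
          link_constraint R0 c,
          Num.floor (2 `^ (n%:R * R0)) <= #|message c|%:Z &
          forall (d : measure_display) (Omega : measurableType d)
            (Pr : probability Omega R) (M : Omega -> message c)
            (Z : 'I_n -> {RV Pr >-> R}),
            channel_law M Z ->
            (error_probability alpha M Z <= eps%:E)%E].
Proof.
exists 1%N => -[//|n] _.
have a0 : alpha - 1 != 0 by rewrite subr_eq0.
set N := Num.truncn (2 `^ (n.+1%:R * R0) : R).
pose K (i : 'I_n.+1) := if i == ord0 then N else 1%N.
(* This step gives the fictitious symbol [K i * D i / (alpha - 1)] energy exactly [P]. *)
pose D (i : 'I_n.+1) : R := Num.sqrt P * `|alpha - 1| / (K i)%:R.
have K_gt0 i : (0 < K i)%N.
  rewrite /K; case: ifP => // _; rewrite truncn_gt0.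
  (* [N] is positive because the exponent is nonnegative, so the power is at least [1]. *)
  by rewrite -[leLHS](powRr0 2) ler_powR ?ler1n// mulr_ge0// ltW.
have D_gt0 i : 0 < D i by rewrite !mulr_gt0 ?sqrtr_gt0 ?normr_gt0 ?invr_gt0 ?ltr0n.
have prodK : (\prod_(i < n.+1) K i)%N = N.
  by rewrite big_ord_recl big1 ?muln1.
have K_link : (\prod_(i < n.+1) K i)%N%:R <= 2 `^ (n.+1%:R * R0) :> R.
  by rewrite prodK truncn_le powR_ge0.
exists (MQScheme K_gt0 D_gt0 K_link); split.
- apply: power_constraint_mq_code => // i /=.
  have Ki0 : (K i)%:R != 0 :> R by rewrite pnatr_eq0 -lt0n.
  rewrite /D mulrC (mulrC (K i)%:R) divfK// exprMn exprVn exprMn real_normK ?num_real//.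
  by rewrite mulrC mulfK ?sqrf_eq0// sqr_sqrtr// ltW.
- exact: link_constraint_mq_code.
- rewrite /= card_mq_index /= prodK /N truncn_floor powR_ge0 gez0_abs//.
  by rewrite floor_ge0 powR_ge0.
- move=> d Omega Pr M Z _; rewrite /error_probability.
  (* Decoding succeeds at every outcome, so the error event is empty. *)
  rewrite [X in Pr X](_ : _ = set0) ?measure0 ?lee_fin ?ltW//.
  by apply/seteqP; split => w //; case; exact: estimate_mq_code.
Qed.
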